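(* Let $k$ be a field and $\Lambda$ a $k$-algebra. Then $\Lambda$ is a generalized elementary algebra which can be lifted, has nilpotent Jacobson radical $r=r(\Lambda)$ and has a complete set of pairwise orthogonal idempotents if and only if $\Lambda$ is isomorphic to a path algebra with relations.
   Context: Algebras are associative over the field $k$ and need not have a unity element; $r(\Lambda)$ denotes the Jacobson radical. An algebra $\Lambda$ *can be lifted* if there is a subalgebra $A$ of $\Lambda$ with $\Lambda=A\oplus r(\Lambda)$ as vector spaces. $\Lambda$ is a *generalized elementary algebra* if $\Lambda/r(\Lambda)\cong\bigoplus_{i\in I}B_{ii}$ as algebras for some non-empty set $I$, with $B_{ii}=k$ for every $i\in I$. A family $\{e_{ii}\}_{i\in I}$ (with $I$ a non-empty set) of elements of $\Lambda$ is a *complete set of pairwise orthogonal idempotents* if (i) $e_{ii}e_{jj}=\delta_{ij}e_{ii}$ for all $i,j\in I$; (ii) for each $x\in\Lambda$ there is a finite $F\subseteq I$ with $(\sum_{i\in F}e_{ii})x=x(\sum_{i\in F}e_{ii})=x$; (iii) $e_{ii}\neq0$ for all $i\in I$. Let $D$ be a directed graph (possibly infinite, loops and multiple arrows allowed) with non-empty vertex set $D_0$. The path algebra $kD$ is the $k$-algebra with basis all paths of $D$, including the paths $e_{ii}$ of length $0$ at the vertices $i$, with multiplication by concatenation (product $\alpha\beta$ is the path $\alpha$ followed by $\beta$ if $\alpha$ ends where $\beta$ starts, and $0$ otherwise). Let $J$ be the ideal generated by all arrows. A *path algebra with relations* is a quotient $kD/(\rho)$ where $\rho$ is a non-empty subset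 of $kD$ and the ideal $(\rho)$ it generates satisfies $J^t\subseteq(\rho)\subseteq J^2$ for some positive integer $t$. *)

(* Defs.v *)
(* Mathematical Components, with classical sets and multinomials' monalg. *)
From HB Require Import structures.
From mathcomp Require Import all_boot all_order all_algebra finmap.
From mathcomp Require Import ring_quotient.
From mathcomp Require Import boolp classical_sets.
From mathcomp Require Import monalg.

Set Implicit Arguments.
Unset Strict Implicit.
Unset Printing Implicit Defensive.

Import GRing.Theory.

Local Open Scope classical_set_scope.
Local Open Scope ring_scope.

Reserved Notation "x ** y" (at level 40, left associativity).

(* Associative k-algebras, not necessarily with a unity: MathComp's algType
   always has one. *)
HB.mixin Record isNuAlgebra (k : fieldType) V of GRing.Lmodule k V := {
  numul : V -> V -> V;
  numulA : associative numul;
  numulDl : left_distributive numul +%R;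
  numulDr : right_distributive numul +%R;
  nuscaleAl : forall (c : k) (x y : V), c *: numul x y = numul (c *: x) y;
  nuscaleAr : forall (c : k) (x y : V), c *: numul x y = numul x (c *: y)
}.

#[short(type="nuAlgType")]
HB.structure Definition NuAlgebra (k : fieldType) :=
  {V of isNuAlgebra k V & GRing.Lmodule k V}.

Notation "x ** y" := (numul x y) : ring_scope.

Definition alg_iso (k : fieldType) (A B : nuAlgType k) : Prop :=
  exists f : {linear A -> B}, bijective f /\ {morph f : x y / x ** y}.

Section Basics.
Context {k : fieldType} {L : nuAlgType k}.
Implicit Types (x y z : L) (A B : set L).

Lemma numul0l y : 0 ** y = 0 :> L.
Proof. by apply: (addIr (0 ** y)); rewrite -numulDl !add0r. Qed.

Lemma numul0r x : x ** 0 = 0 :> L.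
Proof. by apply: (addIr (x ** 0)); rewrite -numulDr !add0r. Qed.

Lemma numulNl x y : (- x) ** y = - (x ** y).
Proof. by rewrite -scaleN1r -nuscaleAl scaleN1r. Qed.

Lemma numulNr x y : x ** (- y) = - (x ** y).
Proof. by rewrite -scaleN1r -nuscaleAr scaleN1r. Qed.

Lemma numulBl x y z : (x - y) ** z = x ** z - y ** z.
Proof. by rewrite numulDl numulNl. Qed.

Lemma numulBr x y z : x ** (y - z) = x ** y - x ** z.
Proof. by rewrite numulDr numulNr. Qed.

Definition is_subspace A : Prop :=
  [/\ A 0, forall x y, A x -> A y -> A (x + y)
    & forall (c : k) x, A x -> A (c *: x)].

Definition is_subalgebra A : Prop :=
  is_subspace A /\ forall x y, A x -> A y -> A (x ** y).

Definition is_ideal A : Prop :=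
  [/\ is_subspace A, forall x y, A y -> A (x ** y)
    & forall x y, A x -> A (x ** y)].

Definition set_mul A B : set L :=
  [set x | exists2 s : seq (L * L), {in s, forall p, A p.1 /\ B p.2}
                                  & x = \sum_(p <- s) p.1 ** p.2].

(* A^n.  The case n = 1 has to be treated apart: without a unity, L A may be
   smaller than A. *)
Definition set_exp A (n : nat) : set L :=
  if n is m.+1 then iter m (fun P => set_mul P A) A else setT.

Definition is_nilpotent A : Prop :=
  exists2 n, (0 < n)%N & set_exp A n `<=` [set 0].

End Basics.

Record ideal (k : fieldType) (L : nuAlgType k) := Ideal {
  ideal_set :> set L;
  idealP : is_ideal ideal_set
}.

Section IdealGen.
Context {k : fieldType} {L : nuAlgType k}.

Definition gen_set (A : set L) : set L :=
  [set x | forall I : ideal L, A `<=` I -> ideal_set I x].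

Lemma gen_set_ideal A : is_ideal (gen_set A).
Proof.
split; first split.
- by move=> I _; case: (idealP I) => -[].
- move=> x y hx hy I AI; case: (idealP I) => -[_ hD _] _ _.
  by apply: hD; [exact: hx | exact: hy].
- move=> c x hx I AI; case: (idealP I) => -[_ _ hZ] _ _.
  by apply: hZ; exact: hx.
- move=> x y hy I AI; case: (idealP I) => _ hl _; apply: hl; exact: hy.
- move=> x y hx I AI; case: (idealP I) => _ _ hr; apply: hr; exact: hx.
Qed.

Definition ideal_gen (A : set L) : ideal L := Ideal (gen_set_ideal A).

End IdealGen.

Section Quotient.
Context {k : fieldType} {L : nuAlgType k} (I : ideal L).

Definition ideal_pred : {pred L} := fun x => `[< ideal_set I x >].

Lemma ideal_predE x : (x \in ideal_pred) = `[< ideal_set I x >].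
Proof. by []. Qed.

Lemma ideal_pred_zmod : zmod_closed ideal_pred.
Proof.
case: (idealP I) => -[h0 hD hZ] _ _; split=> [|x y].
  by rewrite ideal_predE; apply/asboolP.
rewrite !ideal_predE => /asboolP hx /asboolP hy; apply/asboolP.
by apply: hD => //; rewrite -scaleN1r; apply: hZ.
Qed.

HB.instance Definition _ := GRing.isZmodClosed.Build L ideal_pred
  ideal_pred_zmod.

Definition quot_alg : Type := Quotient.quot ideal_pred.
HB.instance Definition _ := GRing.Zmodule.on quot_alg.

Definition quot_pi (x : L) : quot_alg := (\pi_(Quotient.quot ideal_pred) x)%qT.
Definition quot_repr (x : quot_alg) : L :=
  repr (x : Quotient.quot ideal_pred).

Lemma quot_reprK : cancel quot_repr quot_pi.
Proof. by move=> x; rewrite /quot_pi /quot_repr reprK. Qed.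

Lemma quot_piE x y : (quot_pi x = quot_pi y) <-> ideal_set I (x - y).
Proof.
split=> [/eqP|h]; last apply/eqP.
  by rewrite /quot_pi -Quotient.idealrBE => /asboolP.
by rewrite /quot_pi -Quotient.idealrBE; apply/asboolP.
Qed.

Lemma quot_piD x y : quot_pi (x + y) = quot_pi x + quot_pi y.
Proof. exact: (pi_addr x y). Qed.

Definition quot_scale (c : k) (x : quot_alg) := quot_pi (c *: quot_repr x).
Definition quot_mul (x y : quot_alg) := quot_pi (quot_repr x ** quot_repr y).

Lemma quot_repr_pi x : ideal_set I (quot_repr (quot_pi x) - x).
Proof. by apply/quot_piE; rewrite quot_reprK. Qed.

Lemma quot_pi_scale c x : quot_scale c (quot_pi x) = quot_pi (c *: x).
Proof.
apply/quot_piE; rewrite -scalerBr; case: (idealP I) => -[_ _ hZ] _ _.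
exact/hZ/quot_repr_pi.
Qed.

Lemma quot_pi_mul x y : quot_mul (quot_pi x) (quot_pi y) = quot_pi (x ** y).
Proof.
apply/quot_piE; case: (idealP I) => -[_ hD _] hl hr.
rewrite -[X in X - _](subrK (quot_repr (quot_pi x) ** y)) -numulBr.
by rewrite -addrA -numulBl; apply: hD; [apply: hl | apply: hr];
  apply: quot_repr_pi.
Qed.

Lemma quot_scaleA c d x : quot_scale c (quot_scale d x) = quot_scale (c * d) x.
Proof. by rewrite -[x]quot_reprK !quot_pi_scale scalerA. Qed.

Lemma quot_scale1 : left_id 1 quot_scale.
Proof. by move=> x; rewrite -[x]quot_reprK quot_pi_scale scale1r. Qed.

Lemma quot_scaleDr : right_distributive quot_scale +%R.
Proof.
move=> c x y; rewrite -[x]quot_reprK -[y]quot_reprK.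
by rewrite -quot_piD !quot_pi_scale -quot_piD scalerDr.
Qed.

Lemma quot_scaleDl x : {morph quot_scale^~ x : c d / c + d}.
Proof.
by move=> c d; rewrite -[x]quot_reprK !quot_pi_scale -quot_piD scalerDl.
Qed.

HB.instance Definition _ := GRing.Zmodule_isLmodule.Build k quot_alg
  quot_scaleA quot_scale1 quot_scaleDr quot_scaleDl.

Lemma quot_piZ c x : quot_pi (c *: x) = c *: quot_pi x.
Proof. by rewrite -quot_pi_scale. Qed.

Lemma quot_mulA : associative quot_mul.
Proof.
move=> x y z; rewrite -[x]quot_reprK -[y]quot_reprK -[z]quot_reprK.
by rewrite !quot_pi_mul numulA.
Qed.

Lemma quot_mulDl : left_distributive quot_mul +%R.
Proof.
move=> x y z; rewrite -[x]quot_reprK -[y]quot_reprK -[z]quot_reprK.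
by rewrite -quot_piD !quot_pi_mul -quot_piD numulDl.
Qed.

Lemma quot_mulDr : right_distributive quot_mul +%R.
Proof.
move=> x y z; rewrite -[x]quot_reprK -[y]quot_reprK -[z]quot_reprK.
by rewrite -quot_piD !quot_pi_mul -quot_piD numulDr.
Qed.

Lemma quot_scaleAl (c : k) (x y : quot_alg) :
  c *: quot_mul x y = quot_mul (c *: x) y.
Proof.
rewrite -[x]quot_reprK -[y]quot_reprK quot_pi_mul.
by rewrite -!quot_piZ quot_pi_mul nuscaleAl.
Qed.

Lemma quot_scaleAr (c : k) (x y : quot_alg) :
  c *: quot_mul x y = quot_mul x (c *: y).
Proof.
rewrite -[x]quot_reprK -[y]quot_reprK quot_pi_mul.
by rewrite -!quot_piZ quot_pi_mul nuscaleAr.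
Qed.

HB.instance Definition _ := isNuAlgebra.Build k quot_alg
  quot_mulA quot_mulDl quot_mulDr quot_scaleAl quot_scaleAr.

End Quotient.

Section Jacobson.
Context {k : fieldType} (L : nuAlgType k).

Definition is_module (M : lmodType k) (act : L -> M -> M) : Prop :=
  [/\ forall x y m, act (x ** y) m = act x (act y m),
      forall x, linear (act x)
    & forall m, linear (act^~ m)].

(* Without a unity, L M = 0 has to be excluded explicitly. *)
Definition is_simple_module (M : lmodType k) (act : L -> M -> M) : Prop :=
  [/\ is_module act, exists x m, act x m != 0
    & forall N : set M,
        N 0 -> (forall (c : k) m n, N m -> N n -> N (c *: m + n)) ->
        (forall x m, N m -> N (act x m)) ->
        N = [set 0] \/ N = setT].

Definition jacobson_set : set L :=
  [set x | forall (M : lmodType k) (act : L -> M -> M),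
     is_simple_module act -> forall m, act x m = 0].

Lemma jacobson_ideal : is_ideal jacobson_set.
Proof.
split; first split.
- move=> M act [[_ _ h] _ _] m.
  by move: (h m (-1) 0 0); rewrite scaler0 addr0 scaleN1r addNr.
- move=> x y hx hy M act s m; case: (s) => -[_ _ h] _ _.
  by move: (h m 1 x y); rewrite !scale1r => ->; rewrite hx // hy // addr0.
- move=> c x hx M act s m; case: (s) => -[_ _ h] _ _.
  have h0 : act 0 m = 0.
    by move: (h m (-1) 0 0); rewrite scaler0 addr0 scaleN1r addNr.
  by move: (h m c x 0); rewrite !addr0 => ->; rewrite hx // scaler0 h0 addr0.
- move=> x y hy M act s m; case: (s) => -[hM hl _] _ _.
  rewrite hM hy //.
  by move: (hl x (-1) 0 0); rewrite scaler0 addr0 scaleN1r addNr.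
- by move=> x y hx M act s m; case: (s) => -[hM _ _] _ _; rewrite hM hx.
Qed.

Definition jacobson : ideal L := Ideal jacobson_ideal.

End Jacobson.

(* The direct sum of copies of k indexed by I: finitely supported functions
   I -> k with pointwise multiplication. *)
Section DirectSum.
Context (k : fieldType) (I : choiceType).

Definition dsum : Type := {malg k[I]}.
HB.instance Definition _ := GRing.Lmodule.on dsum.

Implicit Types x y z : dsum.

Definition dsum_mul x y : dsum := [malg i in msupp x => x@_i * y@_i].

Lemma dsum_mulE x y i : (dsum_mul x y)@_i = x@_i * y@_i.
Proof. by rewrite mcoeffE; case: msuppP => //; rewrite mul0r. Qed.

Lemma dsum_mulA : associative dsum_mul.
Proof. by move=> x y z; apply/malgP=> i; rewrite !dsum_mulE mulrA. Qed.

Lemma dsum_mulDl : left_distributive dsum_mul +%R.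
Proof.
by move=> x y z; apply/malgP=> i; rewrite mcoeffD !dsum_mulE mcoeffD mulrDl.
Qed.

Lemma dsum_mulDr : right_distributive dsum_mul +%R.
Proof.
by move=> x y z; apply/malgP=> i; rewrite mcoeffD !dsum_mulE mcoeffD mulrDr.
Qed.

Lemma dsum_scaleAl (c : k) x y : c *: dsum_mul x y = dsum_mul (c *: x) y.
Proof.
by apply/malgP=> i; rewrite mcoeffZ !dsum_mulE mcoeffZ mulrA.
Qed.

Lemma dsum_scaleAr (c : k) x y : c *: dsum_mul x y = dsum_mul x (c *: y).
Proof.
by apply/malgP=> i; rewrite mcoeffZ !dsum_mulE mcoeffZ mulrCA.
Qed.

HB.instance Definition _ := isNuAlgebra.Build k dsum
  dsum_mulA dsum_mulDl dsum_mulDr dsum_scaleAl dsum_scaleAr.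

End DirectSum.

(* Loops, multiple arrows and infinitely many vertices or arrows are allowed. *)
Record quiver := Quiver {
  vertex : choiceType;
  arrow : choiceType;
  asrc : arrow -> vertex;
  atgt : arrow -> vertex
}.

Section Paths.
Context {D : quiver}.

Fixpoint is_walk (i : vertex D) (s : seq (arrow D)) : bool :=
  if s is a :: s' then (asrc a == i) && is_walk (atgt a) s' else true.

(* A path is its starting vertex together with its sequence of arrows, in the
   order in which they are followed. *)
Record qpath := QPath {
  qpath_val : vertex D * seq (arrow D);
  qpath_walk : is_walk qpath_val.1 qpath_val.2
}.

HB.instance Definition _ := [isSub for qpath_val].
HB.instance Definition _ := [Choice of qpath by <:].

Definition psrc (p : qpath) : vertex D := (qpath_val p).1.
Definition parrows (p : qpath) : seq (arrow D) := (qpath_val p).2.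
Definition ptgt (p : qpath) : vertex D := last (psrc p) (map (@atgt D) (parrows p)).

Lemma arrow_walk (a : arrow D) : is_walk (asrc a, [:: a]).1 (asrc a, [:: a]).2.
Proof. by rewrite /= eqxx. Qed.

Definition vertex_path (i : vertex D) : qpath := @QPath (i, [::]) isT.
Definition arrow_path (a : arrow D) : qpath := QPath (arrow_walk a).

Lemma is_walk_cat i s t :
  is_walk i (s ++ t) = is_walk i s && is_walk (last i (map (@atgt D) s)) t.
Proof. by elim: s i => //= a s IHs i; rewrite IHs andbA. Qed.

(* p followed by q, or None if p does not end where q starts; insub succeeds
   by is_walk_cat. *)
Definition pcat (p q : qpath) : option qpath :=
  if ptgt p == psrc q then insub (psrc p, parrows p ++ parrows q) else None.

Variant pcat_spec p q : option qpath -> Prop :=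
| PcatSome r of ptgt p = psrc q & psrc r = psrc p & ptgt r = ptgt q
    & parrows r = parrows p ++ parrows q : pcat_spec p q (Some r)
| PcatNone of ptgt p != psrc q : pcat_spec p q None.

Lemma pcatP p q : pcat_spec p q (pcat p q).
Proof.
rewrite /pcat; case: eqP => [e|/eqP e]; last by constructor.
case: insubP => [r _ er|].
  have es : psrc r = psrc p by rewrite /psrc er.
  have ea : parrows r = parrows p ++ parrows q by rewrite /parrows er.
  by constructor=> //; rewrite /ptgt es ea map_cat last_cat -/(ptgt p) e.
rewrite /= is_walk_cat -/(ptgt p) e.
by move: (qpath_walk p) (qpath_walk q); rewrite /psrc /parrows => -> ->.
Qed.

Lemma qpath_eq p q : psrc p = psrc q -> parrows p = parrows q -> p = q.
Proof.
move=> es ea; apply: val_inj; rewrite /= (surjective_pairing (qpath_val p)).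
by rewrite -/(psrc p) -/(parrows p) es ea -surjective_pairing.
Qed.

Lemma pcatA p q r :
  obind (pcat p) (pcat q r) = obind (pcat^~ r) (pcat p q).
Proof.
case: (pcatP q r) => [qr e1 s1 t1 a1|n1]; case: (pcatP p q) => [pq e2 s2 t2 a2|n2] //=.
- case: (pcatP p qr) => [u e3 s3 t3 a3|]; case: (pcatP pq r) => [v e4 s4 t4 a4|] //.
  + by congr Some; apply: qpath_eq; rewrite ?s3 ?s4 // a3 a4 a1 a2 catA.
  + by rewrite t2 e1 eqxx.
  + by rewrite s1 e2 eqxx.
- by case: (pcatP p qr) => // u; rewrite s1 => e; rewrite e eqxx in n2.
- by case: (pcatP pq r) => // u; rewrite t2 => e; rewrite e eqxx in n1.
Qed.

End Paths.
Arguments qpath : clear implicits.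

HB.lock Definition path_mul (k : fieldType) (D : quiver)
    (x y : {malg k[qpath D]}) : {malg k[qpath D]} :=
  \sum_(p <- msupp x) \sum_(q <- msupp y)
    oapp (fun r => << x@_p * y@_q *g r >>) 0 (pcat p q).
Canonical path_mul_unlockable := Unlockable path_mul.unlock.

Section PathAlgebra.
Context (k : fieldType) (D : quiver).

Definition path_alg : Type := {malg k[qpath D]}.
HB.instance Definition _ := GRing.Lmodule.on path_alg.

Implicit Types (x y z : path_alg) (p q r : qpath D).

Local Notation path_mul := (@path_mul k D : path_alg -> path_alg -> path_alg).

Let term x y p q : path_alg :=
  oapp (fun r => << x@_p * y@_q *g r >>) 0 (pcat p q).

Lemma path_mulEw (d1 d2 : {fset qpath D}) x y :
  (msupp x `<=` d1 -> msupp y `<=` d2 ->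
  path_mul x y = \sum_(p <- d1) \sum_(q <- d2) term x y p q)%fset.
Proof.
move=> le1 le2; rewrite unlock (big_fset_incl _ le1) /=.
  apply/eq_bigr=> p _; apply/big_fset_incl => // q _ /mcoeff_outdom ->.
  by case: (pcat p q) => //= r; rewrite mulr0 monalgU0.
move=> p _ /mcoeff_outdom xp; rewrite big1 // => q _; rewrite xp.
by case: (pcat p q) => //= r; rewrite mul0r monalgU0.
Qed.

Lemma path_mulDl : left_distributive path_mul +%R.
Proof.
move=> x y z.
rewrite (path_mulEw (msuppD_le x y) (fsubset_refl _)).
rewrite (path_mulEw (fsubsetUl _ (msupp y)) (fsubset_refl (msupp z))).
rewrite (path_mulEw (fsubsetUr (msupp x) _) (fsubset_refl (msupp z))).
rewrite -big_split /=; apply/eq_bigr=> p _.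
rewrite -big_split /=; apply/eq_bigr=> q _; rewrite /term.
by case: (pcat p q) => [r|] /=; rewrite ?addr0 // mcoeffD mulrDl monalgUD.
Qed.

Lemma path_mulDr : right_distributive path_mul +%R.
Proof.
move=> z x y.
rewrite (path_mulEw (fsubset_refl _) (msuppD_le x y)).
rewrite (path_mulEw (fsubset_refl (msupp z)) (fsubsetUl _ (msupp y))).
rewrite (path_mulEw (fsubset_refl (msupp z)) (fsubsetUr (msupp x) _)).
rewrite -big_split /=; apply/eq_bigr=> p _.
rewrite -big_split /=; apply/eq_bigr=> q _; rewrite /term.
by case: (pcat p q) => [r|] /=; rewrite ?addr0 // mcoeffD mulrDr monalgUD.
Qed.

Lemma path_mulUU (c d : k) p q :
  path_mul << c *g p >> << d *g q >> =
  oapp (fun r => << c * d *g r >>) 0 (pcat p q).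
Proof.
by rewrite (path_mulEw msuppU_le msuppU_le) !big_seq_fset1 /term !mcoeffUU.
Qed.

Lemma path_mul0l y : path_mul 0 y = 0.
Proof. by rewrite unlock msupp0 big_seq_fset0. Qed.

Lemma path_mul0r x : path_mul x 0 = 0.
Proof. by rewrite unlock big1 // => p _; rewrite msupp0 big_seq_fset0. Qed.

Lemma path_alg_ind (P : path_alg -> Prop) :
  P 0 -> (forall x y, P x -> P y -> P (x + y)) ->
  (forall c p, P << c *g p >>) -> forall x, P x.
Proof.
by move=> P0 PD PU x; rewrite (monalgE x); elim/big_ind: _ => // p _; exact: PU.
Qed.

Lemma path_mulA : associative path_mul.
Proof.
pose assoc x y z := path_mul x (path_mul y z) = path_mul (path_mul x y) z.
have ax y z : (forall c p, assoc << c *g p >> y z) -> forall x, assoc x y z.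
  move=> U; apply: path_alg_ind => [|x1 x2 IH1 IH2|//]; rewrite /assoc.
    by rewrite (path_mul0l y) (path_mul0l z) (path_mul0l (path_mul y z)).
  rewrite (path_mulDl x1 x2 y) (path_mulDl x1 x2 (path_mul y z)) IH1 IH2.
  by rewrite (path_mulDl (path_mul x1 y) (path_mul x2 y) z).
have ay x z : (forall c p, assoc x << c *g p >> z) -> forall y, assoc x y z.
  move=> U; apply: path_alg_ind => [|y1 y2 IH1 IH2|//]; rewrite /assoc.
    by rewrite (path_mul0r x) (path_mul0l z) (path_mul0r x).
  rewrite (path_mulDl y1 y2 z) (path_mulDr x y1 y2).
  rewrite (path_mulDr x (path_mul y1 z) (path_mul y2 z)) IH1 IH2.
  by rewrite (path_mulDl (path_mul x y1) (path_mul x y2) z).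
have az x y : (forall c p, assoc x y << c *g p >>) -> forall z, assoc x y z.
  move=> U; apply: path_alg_ind => [|z1 z2 IH1 IH2|//]; rewrite /assoc.
    by rewrite (path_mul0r y) (path_mul0r x) (path_mul0r (path_mul x y)).
  rewrite (path_mulDr y z1 z2).
  rewrite (path_mulDr x (path_mul y z1) (path_mul y z2)) IH1 IH2.
  by rewrite (path_mulDr (path_mul x y) z1 z2).
move=> x y z; apply: (ax) => c p; apply: (ay) => d q; apply: (az) => e r.
rewrite /assoc; apply: etrans (congr1 _ (path_mulUU d e q r)) _.
apply: etrans (esym (congr1 (path_mul^~ _) (path_mulUU c d p q))).
transitivity (oapp (fun v => << c * d * e *g v >> : path_alg) 0
                (obind (pcat p) (pcat q r))); last rewrite pcatA.
  case: (pcat q r) => [v|] /=; last exact: path_mul0r.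
  by rewrite (path_mulUU c (d * e) p v) mulrA.
case: (pcat p q) => [v|] /=; last by rewrite (path_mul0l << e *g r >>).
by rewrite (path_mulUU (c * d) e v r).
Qed.

Lemma path_scaleU (c d : k) p : c *: << d *g p >> = << c * d *g p >> :> path_alg.
Proof.
apply/malgP=> q; apply: etrans (mcoeffZ _ _ _) _.
apply: etrans (congr1 (GRing.mul c) (mcoeffU _ _ _)) _.
by apply: etrans (esym (mcoeffU _ _ _)); rewrite mulrnAr.
Qed.

Lemma path_scaleAl (c : k) x y : c *: path_mul x y = path_mul (c *: x) y.
Proof.
rewrite (path_mulEw (msuppZ_le c x) (fsubset_refl (msupp y))).
rewrite (path_mulEw (fsubset_refl (msupp x)) (fsubset_refl (msupp y))).
rewrite scaler_sumr; apply/eq_bigr=> p _.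
rewrite scaler_sumr; apply/eq_bigr=> q _; rewrite /term.
case: (pcat p q) => [r|] /=; last by rewrite scaler0.
by rewrite path_scaleU mcoeffZ mulrA.
Qed.

Lemma path_scaleAr (c : k) x y : c *: path_mul x y = path_mul x (c *: y).
Proof.
rewrite (path_mulEw (fsubset_refl (msupp x)) (msuppZ_le c y)).
rewrite (path_mulEw (fsubset_refl (msupp x)) (fsubset_refl (msupp y))).
rewrite scaler_sumr; apply/eq_bigr=> p _.
rewrite scaler_sumr; apply/eq_bigr=> q _; rewrite /term.
case: (pcat p q) => [r|] /=; last by rewrite scaler0.
by rewrite path_scaleU mcoeffZ mulrCA.
Qed.

HB.instance Definition _ := isNuAlgebra.Build k path_alg
  path_mulA path_mulDl path_mulDr path_scaleAl path_scaleAr.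

Definition arrow_ideal : ideal path_alg :=
  ideal_gen [set (<< arrow_path a >> : path_alg) | a in setT].

Definition is_relation_set (rho : set path_alg) : Prop :=
  rho !=set0 /\
  exists2 t, (0 < t)%N &
    set_exp arrow_ideal t `<=` ideal_gen rho /\
    ideal_gen rho `<=` set_exp arrow_ideal 2.

End PathAlgebra.

Section Properties.
Context {k : fieldType}.
Implicit Type L : nuAlgType k.

Definition generalized_elementary L : Prop :=
  exists I : choiceType,
    inhabited I /\ alg_iso (quot_alg (jacobson L)) (dsum k I).

Definition can_be_lifted L : Prop :=
  exists A : set L,
    [/\ is_subalgebra A,
        forall x, exists a r, [/\ A a, ideal_set (jacobson L) r & x = a + r]
      & A `&` jacobson L = [set 0]].

Definition complete_orthogonal_idempotents L (I : choiceType) (e : I -> L) :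
    Prop :=
  [/\ forall i j, e i ** e j = if i == j then e i else 0,
      forall x, exists F : {fset I},
        (\sum_(i <- F) e i) ** x = x /\ x ** (\sum_(i <- F) e i) = x
    & forall i, e i != 0].

Definition has_complete_orthogonal_idempotents L : Prop :=
  exists (I : choiceType) (e : I -> L),
    inhabited I /\ complete_orthogonal_idempotents e.

Definition is_path_algebra_with_relations L : Prop :=
  exists (D : quiver) (rho : set (path_alg k D)),
    [/\ inhabited (vertex D), is_relation_set rho
      & alg_iso L (quot_alg (ideal_gen rho))].

End Properties.

(* Main.v *)
Require Import Defs.
From mathcomp Require Import all_boot all_algebra.
From HB Require Import structures.
From mathcomp Require Import finmap boolp classical_sets monalg.

(** Both directions study surjective morphisms [phi : kD -> L] from a path
    algebra whose kernel lies between a power of the arrow ideal [J] and [J^2];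
    an isomorphism of [L] with a path algebra with relations is such a [phi].

    Given [phi], the ideal [phi(J)] is nilpotent, hence lies in the radical
    ([nilpotent_sub_jacobson]).  As the kernel of [phi] is inside [J], the
    coefficient of each vertex descends to a character of [L]; a character kills
    the radical ([jacobson_character]), so the radical is exactly [phi(J)]
    ([jacobson_image]).  The span of the vertices is a complement of [J] that is
    a direct sum of copies of [k], and finite sums of vertices are local units;
    the four properties of [L] are the images of these facts.

    Conversely, let [L = A + r] with [A] isomorphic to a direct sum of copies of
    [k], and let [e i] be the element of [A] that corresponds to the [i]-th copy
    of [k].  The [e i] need not be the given complete set of idempotents, but
    they still act as local units on the radical ([radical_local_unit]): modulo
    the next power of [r], a local unit [u] of [x] can be replaced by a finite
    sum of the [e i], and the powers of [r] end at zero.  Hence [r] is spanned by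
    the corners [e i ** x ** e j].  Choose corners that form a basis of [r]
    modulo [r^2] ([basis_modulo]) and take them as the arrows from [i] to [j] of
    a quiver whose vertices are the indices [i].  Sending a path to the product
    of its arrows is a morphism [presentation].  It is onto because generators
    of [r] modulo [r^2] generate [r], the radical being nilpotent
    ([presentation_surj]); its kernel contains [J^n] when [r^n = 0]; and its
    kernel is inside [J^2] because the vertices are independent modulo [r] and
    the arrows are independent modulo [r^2] ([presentation_ker]). *)

Set Implicit Arguments.
Unset Strict Implicit.
Unset Printing Implicit Defensive.

Import GRing.Theory.

Local Open Scope classical_set_scope.
Local Open Scope ring_scope.

(** * Subspaces, ideals and their powers *)

Section Subspaces.
Context {k : fieldType} {L : nuAlgType k}.
Implicit Types (x y z : L) (A B P Q : set L).

Lemma subspaceB A x y : is_subspace A -> A x -> A y -> A (x - y).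
Proof. by case=> _ hD hZ Ax Ay; rewrite -scaleN1r; apply: hD => //; apply: hZ. Qed.

Lemma subspaceN A x : is_subspace A -> A (- x) -> A x.
Proof. by case=> _ _ hZ /(hZ (-1)); rewrite scaleN1r opprK. Qed.

Lemma subspace_sum A (K : Type) (s : seq K) (P : pred K) (F : K -> L) :
  is_subspace A -> (forall i, P i -> A (F i)) -> A (\sum_(i <- s | P i) F i).
Proof. by case=> h0 hD _ hF; elim/big_ind: _. Qed.

Lemma subspace_sum_seq A (K : eqType) (s : seq K) (F : K -> L) :
  is_subspace A -> {in s, forall i, A (F i)} -> A (\sum_(i <- s) F i).
Proof. by move=> sA hF; rewrite big_seq; apply: subspace_sum. Qed.

Lemma numul_sumr (K : Type) (s : seq K) (P : pred K) (F : K -> L) x :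
  x ** (\sum_(i <- s | P i) F i) = \sum_(i <- s | P i) x ** F i.
Proof. by apply: (big_morph (numul x)) => [y z|]; rewrite ?numulDr ?numul0r. Qed.

Lemma numul_suml (K : Type) (s : seq K) (P : pred K) (F : K -> L) x :
  (\sum_(i <- s | P i) F i) ** x = \sum_(i <- s | P i) F i ** x.
Proof. by apply: (big_morph (numul^~ x)) => [y z|]; rewrite ?numulDl ?numul0l. Qed.

Lemma set_mul_mem P A x y : P x -> A y -> set_mul P A (x ** y).
Proof.
move=> Px Ay; exists [:: (x, y)]; last by rewrite big_seq1.
by move=> p; rewrite inE => /eqP ->.
Qed.

Lemma set_mul_sub P A Q : is_subspace Q ->
  (forall x y, P x -> A y -> Q (x ** y)) -> set_mul P A `<=` Q.
Proof.
move=> sQ hQ _ [s hs ->]; apply: subspace_sum_seq => // p /hs[].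
exact: hQ.
Qed.

Lemma set_mul_subspace P A : is_subspace P -> is_subspace (set_mul P A).
Proof.
move=> [_ _ hZ]; split.
- by exists [::] => //; rewrite big_nil.
- move=> _ _ [s hs ->] [t ht ->]; exists (s ++ t); last by rewrite big_cat.
  by move=> p; rewrite mem_cat => /orP[/hs|/ht].
- move=> c _ [s hs ->]; exists [seq (c *: p.1, p.2) | p <- s].
    by move=> _ /mapP[p /hs[Pp Ap] ->]; split=> //=; apply: hZ.
  by rewrite big_map scaler_sumr; apply: eq_bigr => p _; rewrite nuscaleAl.
Qed.

Lemma set_expS A n : set_exp A n.+2 = set_mul (set_exp A n.+1) A.
Proof. by []. Qed.

Lemma set_exp_subspace A n : is_subspace A -> is_subspace (set_exp A n).
Proof.
move=> sA; case: n => [|n]; first by split.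
by elim: n => // n IHn; rewrite set_expS; apply: set_mul_subspace.
Qed.

Lemma set_exp_mulr A n x y : set_exp A n.+1 x -> A y -> set_exp A n.+2 (x ** y).
Proof. by move=> hx hy; rewrite set_expS; apply: set_mul_mem. Qed.

(** [set_exp] is built by multiplying on the right; associativity moves the new
    factor to the left. *)
Lemma set_exp_mull A n x y : is_subspace A ->
  A x -> set_exp A n.+1 y -> set_exp A n.+2 (x ** y).
Proof.
move=> sA Ax; elim: n y => [|n IHn] y hy; first exact: set_exp_mulr.
case: hy => s hs ->; rewrite numul_sumr.
apply: subspace_sum_seq => [|p /hs[hp Ap]]; first exact: set_exp_subspace.
by rewrite numulA; apply: set_exp_mulr Ap; apply: IHn.
Qed.

Lemma set_exp_mul_sqr A n x y : is_subspace A ->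
  set_exp A n.+1 x -> set_exp A 2 y -> set_exp A n.+3 (x ** y).
Proof.
move=> sA hx [s hs ->]; rewrite numul_sumr.
apply: subspace_sum_seq => [|p /hs[p1 p2]]; first exact: set_exp_subspace.
by rewrite numulA; do 2!apply: set_exp_mulr => //.
Qed.

Lemma set_exp_sub A n : is_ideal A -> set_exp A n.+1 `<=` A.
Proof.
move=> [sA hl _]; case: n => // n; rewrite set_expS.
by apply: set_mul_sub => // x y _; apply: hl.
Qed.

Lemma ideal_gen_sub A (I : ideal L) : A `<=` I -> ideal_gen A `<=` I.
Proof. by move=> AI x; apply. Qed.

Lemma sub_ideal_gen A : A `<=` ideal_gen A.
Proof. by move=> x Ax I; apply. Qed.

Lemma ideal_gen_id (I : ideal L) : ideal_gen I = I :> set L.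
Proof. by apply/seteqP; split; [apply: ideal_gen_sub | apply: sub_ideal_gen]. Qed.

End Subspaces.

(** * Morphisms and quotients *)

Section Morphisms.
Context {k : fieldType}.

Definition mult_morph (A B : nuAlgType k) (f : A -> B) : Prop :=
  {morph f : x y / x ** y}.

Definition surj (A B : Type) (f : A -> B) : Prop := forall y, exists x, f x = y.

Lemma preimage_ideal (A B : nuAlgType k) (f : {linear A -> B}) (I : set B) :
  mult_morph f -> is_ideal I -> is_ideal (f @^-1` I).
Proof.
move=> fM [[h0 hD hZ] hl hr]; split; first split.
- by rewrite /preimage /= linear0.
- by move=> x y; rewrite /preimage /= linearD; apply: hD.
- by move=> c x; rewrite /preimage /= linearZ; apply: hZ.
- by move=> x y; rewrite /preimage /= fM; apply: hl.
- by move=> x y; rewrite /preimage /= fM; apply: hr.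
Qed.

Lemma zero_ideal (A : nuAlgType k) : is_ideal [set 0 : A].
Proof.
split; first split=> //.
- by move=> x y -> ->; rewrite addr0.
- by move=> c x ->; rewrite scaler0.
- by move=> x y ->; rewrite numul0r.
- by move=> x y ->; rewrite numul0l.
Qed.

Definition ker_ideal (A B : nuAlgType k) (f : {linear A -> B})
    (fM : mult_morph f) : ideal A :=
  Ideal (preimage_ideal fM (zero_ideal B)).

Lemma image_ideal (A B : nuAlgType k) (f : {linear A -> B}) (I : set A) :
  mult_morph f -> surj f -> is_ideal I -> is_ideal (f @` I).
Proof.
move=> fM fS [[h0 hD hZ] hl hr]; split; first split.
- by exists 0; rewrite ?linear0.
- by move=> _ _ [x Ix <-] [y Iy <-]; exists (x + y); rewrite ?linearD //; apply: hD.
- by move=> c _ [x Ix <-]; exists (c *: x); rewrite ?linearZ //; apply: hZ.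
- move=> x _ [y Iy <-]; have [z <-] := fS x.
  by exists (z ** y); rewrite ?fM //; apply: hl.
- move=> _ y [x Ix <-]; have [z <-] := fS y.
  by exists (x ** z); rewrite ?fM //; apply: hr.
Qed.

Lemma set_exp_morph (A B : nuAlgType k) (f : {linear A -> B})
    (I : set A) (J : set B) n x : mult_morph f -> is_subspace J ->
  (forall y, I y -> J (f y)) -> set_exp I n.+1 x -> set_exp J n.+1 (f x).
Proof.
move=> fM sJ IJ; elim: n x => [|n IHn] x hx; first exact: IJ.
case: hx => s hs ->; rewrite linear_sum.
apply: subspace_sum_seq => [|p /hs[hp Ip]]; first exact: set_exp_subspace.
by rewrite /= fM; apply: set_exp_mulr; [apply: IHn | apply: IJ].
Qed.

Lemma set_exp_image (A B : nuAlgType k) (f : {linear A -> B}) (I : set A) n :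
  mult_morph f -> is_subspace I ->
  set_exp (f @` I) n.+1 `<=` f @` (set_exp I n.+1).
Proof.
move=> fM sI; elim: n => // n IHn; rewrite !set_expS.
have sm := set_exp_subspace n.+2 sI.
apply: set_mul_sub => [|_ _ /IHn[x hx <-] [y hy <-]]; last first.
  by exists (x ** y); rewrite ?fM //; apply: set_mul_mem.
case: sm => h0 hD hZ; split.
- by exists 0; rewrite ?linear0.
- by move=> _ _ [x Ix <-] [y Iy <-]; exists (x + y); rewrite ?linearD //; apply: hD.
- by move=> c _ [x Ix <-]; exists (c *: x); rewrite ?linearZ //; apply: hZ.
Qed.

(** The factorization picks arbitrary preimages; the inclusion of kernels makes
    the result independent of them, hence linear. *)
Lemma factor_surj (A B C : nuAlgType k)
    (f : {linear A -> B}) (g : {linear A -> C}) :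
  mult_morph f -> surj f -> mult_morph g -> (forall x, f x = 0 -> g x = 0) ->
  exists2 h : {linear B -> C}, mult_morph h & forall x, h (f x) = g x.
Proof.
move=> fM /choice[s fK] gM kerfg.
have hE x : g (s (f x)) = g x.
  by apply/eqP; rewrite -subr_eq0 -linearB kerfg // linearB /= fK subrr.
have hlin : linear (g \o s).
  move=> c x y /=.
  by rewrite -[in LHS](fK x) -[in LHS](fK y) -linearP hE linearP.
have hM : mult_morph (g \o s).
  by move=> x y /=; rewrite -{1}(fK x) -{1}(fK y) -fM hE gM.
pose hL := GRing.isLinear.Build k B C _ (g \o s) hlin.
by exists (HB.pack_for {linear B -> C} (g \o s) hL).
Qed.

(** The two factorizations through [f] and through [g] are inverse to each
    other.  This is how all the isomorphisms below are obtained. *)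
Lemma alg_iso_of_kernel (A B C : nuAlgType k)
    (f : {linear A -> B}) (g : {linear A -> C}) :
  mult_morph f -> surj f -> mult_morph g -> surj g ->
  (forall x, f x = 0 <-> g x = 0) -> alg_iso B C.
Proof.
move=> fM fS gM gS kerfg.
have [u uM uE] := factor_surj fM fS gM (fun x => proj1 (kerfg x)).
have [v _ vE] := factor_surj gM gS fM (fun x => proj2 (kerfg x)).
exists u; split=> //; exists v => x.
  by have [y <-] := fS x; rewrite uE vE.
by have [y <-] := gS x; rewrite vE uE.
Qed.

Section Pi.
Context {L : nuAlgType k} (I : ideal L).

Lemma quot_pi_linear : linear (quot_pi I).
Proof. by move=> c x y; rewrite quot_piD quot_piZ. Qed.
HB.instance Definition _ :=
  GRing.isLinear.Build k L (quot_alg I) _ (quot_pi I) quot_pi_linear.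

Lemma quot_pi_morph : mult_morph (quot_pi I).
Proof. by move=> x y; apply: esym; apply: quot_pi_mul. Qed.

Lemma quot_pi_surj : surj (quot_pi I).
Proof. by move=> x; exists (quot_repr x); apply: quot_reprK. Qed.

Lemma quot_pi_eq0 x : quot_pi I x = 0 <-> ideal_set I x.
Proof. by rewrite -(linear0 (quot_pi I)) quot_piE subr0. Qed.

End Pi.
End Morphisms.

(** * Linear extension and bases modulo a subspace *)

Section LinearExtension.
Context {k : fieldType}.

Lemma malg_ind (K : choiceType) (P : {malg k[K]} -> Prop) :
  P 0 -> (forall x y, P x -> P y -> P (x + y)) ->
  (forall c i, P << c *g i >>) -> forall x, P x.
Proof.
by move=> P0 PD PU x; rewrite (monalgE x); elim/big_ind: _ => // i _; apply: PU.
Qed.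

Section Lext.
Context {K : choiceType} {V : lmodType k} (g : K -> V).

Definition lext (x : {malg k[K]}) : V := \sum_(i <- msupp x) x@_i *: g i.

Lemma lextEw (d : {fset K}) x :
  (msupp x `<=` d)%fset -> lext x = \sum_(i <- d) x@_i *: g i.
Proof.
move=> le; rewrite /lext (big_fset_incl _ le) // => i _ /mcoeff_outdom ->.
by rewrite scale0r.
Qed.

Lemma lext_linear : linear lext.
Proof.
move=> c x y.
rewrite (lextEw (d := (msupp x `|` msupp y)%fset)); last first.
  apply: fsubset_trans (msuppD_le _ _) _; apply: fsetSU; exact: msuppZ_le.
rewrite (lextEw (fsubsetUl _ (msupp y))) (lextEw (fsubsetUr (msupp x) _)).
rewrite scaler_sumr -big_split /=; apply: eq_bigr => i _.
by rewrite mcoeffD mcoeffZ scalerDl scalerA.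
Qed.
HB.instance Definition _ :=
  GRing.isLinear.Build k {malg k[K]} V _ lext lext_linear.

Lemma lextU c i : lext << c *g i >> = c *: g i.
Proof. by rewrite (lextEw (msuppU_le)) big_seq_fset1 mcoeffUU. Qed.

Lemma lext1 i : lext << i >> = g i.
Proof. by rewrite lextU scale1r. Qed.

End Lext.

Lemma malg_linear_eq (K : choiceType) (V : lmodType k)
    (f g : {linear {malg k[K]} -> V}) :
  (forall i, f << i >> = g << i >>) -> f =1 g.
Proof.
move=> fg; apply: malg_ind => [|x y fx fy|c i]; first by rewrite !linear0.
  by rewrite !linearD fx fy.
have -> : << c *g i >> = c *: << i >> :> {malg k[K]}.
  by apply/malgP=> j; rewrite mcoeffZ !mcoeffU mulrnAr mulr1.
by rewrite !linearZ fg.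
Qed.

Lemma linear_lext (K : choiceType) (V W : lmodType k) (f : {linear V -> W})
    (g : K -> V) x : f (lext g x) = lext (f \o g) x.
Proof.
by rewrite /lext linear_sum; apply: eq_bigr => i _; rewrite linearZ.
Qed.

Lemma lext_id (K : choiceType) (x : {malg k[K]}) : lext (fun i => << i >>) x = x.
Proof.
by apply: (malg_linear_eq (f := lext _) (g := idfun)) => i; exact: lext1.
Qed.

End LinearExtension.

Section Basis.
Context {k : fieldType} {L : nuAlgType k} {T : choiceType}.
Variables (w : T -> L) (W : set L).
Hypothesis sW : is_subspace W.

Let supported (B : set T) (m : {malg k[T]}) := {in msupp m, forall t, B t}.
Let independent (B : set T) :=
  forall m : {malg k[T]}, supported B m -> W (lext w m) -> m = 0.

(** A combination has finite support, so all of it lies in one member of the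
    chain. *)
Let independent_bigcup (F : set (set T)) :
  F `<=` independent -> total_on F subset ->
  independent (\bigcup_(X in F) X).
Proof.
move=> Find Ftot m Bm Wm; apply: contrapT => m0.
have [X FX Xm] : exists2 X, F X & supported X m.
  have : forall t, t \in (msupp m : seq T) -> (\bigcup_(X in F) X) t by [].
  have : (msupp m : seq T) != [::].
    apply/eqP => e; apply: m0; apply/malgP => t; rewrite mcoeff0.
    by rewrite mcoeff_outdom // -[_ \in _]/(t \in (msupp m : seq T)) e.
  rewrite /supported; change (msupp m != [::] :> seq T ->
    {in (msupp m : seq T), forall t, (\bigcup_(X in F) X) t} ->
    exists2 X, F X & {in (msupp m : seq T), forall t, X t}).
  elim: (msupp m : seq T) => // t [|u s] IHs _ hs.
    have [X FX Xt] := hs t (mem_head _ _).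
    by exists X => // u; rewrite inE => /eqP ->.
  have [|X FX Xs] := IHs isT.
    by move=> v vs; apply: hs; rewrite inE vs orbT.
  have [Y FY Yt] := hs t (mem_head _ _).
  have [XY|YX] := Ftot _ _ FX FY.
    by exists Y => // v; rewrite inE => /orP[/eqP ->|/Xs /XY].
  by exists X => // v; rewrite inE => /orP[/eqP ->|/Xs //]; apply: YX.
exact/m0/(Find X FX).
Qed.

(** A dependence relation that uses [t] can be solved for [w t]. *)
Let maximal_spans (B : set T) : independent B ->
    (forall C, B `<` C -> ~ independent C) ->
  forall t, exists2 m, supported B m & W (w t - lext w m).
Proof.
move=> Bind Bmax t; have [Bt|nBt] := pselect (B t).
  exists << t >>; last by rewrite lext1 subrr; case: sW.
  by move=> u /(fsubsetP msuppU_le); rewrite inE => /eqP ->.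
have /Bmax/existsNP[m /not_implyP[Bm /not_implyP[Wm m0]]] : B `<` B `|` [set t].
  by split=> [u Bu|sub]; [left | apply/nBt/sub; right].
pose m' := m - << m@_t *g t >>.
have Bm' : supported B m'.
  move=> u; rewrite -mcoeff_neq0 mcoeffB mcoeffU.
  have [->|ne] := eqVneq t u; first by rewrite subrr eqxx.
  rewrite subr0 mcoeff_neq0 => /Bm[//|/= e].
  by rewrite e eqxx in ne.
have mt : m@_t != 0.
  apply/eqP => mt; apply: m0; apply: Bind => //.
  by move: Bm'; rewrite /m' mt monalgU0 subr0.
exists (- (m@_t)^-1 *: m').
  by move=> u um; apply: Bm'; apply: (fsubsetP (msuppZ_le _ _)) um.
rewrite linearZ /= scaleNr opprK linearB /= lextU scalerBr scalerA mulVf // scale1r.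
by rewrite addrC subrK; case: sW => _ _; apply.
Qed.

(** Zorn's lemma, applied to the subfamilies of [w] that are linearly
    independent modulo [W].  The chosen subfamily is reindexed by a type of its
    own because it becomes the type of arrows of a quiver. *)
Lemma basis_modulo : exists (K : choiceType) (u : K -> T),
  (forall m : {malg k[K]}, W (lext (w \o u) m) -> m = 0) /\
  forall t, exists m : {malg k[K]}, W (w t - lext (w \o u) m).
Proof.
have [B [Bind Bmax]] := Zorn_bigcup independent_bigcup.
exists {t : T | `[< B t >]}, sval; split=> [m Wm|t].
  pose up := lext (fun b : {t : T | `[< B t >]} => << sval b >> : {malg k[T]}).
  have upE : lext w (up m) = lext (w \o sval) m.
    rewrite linear_lext; apply: eq_bigr => b _ /=; congr (_ *: _); exact: lext1.
  have upm : up m = 0.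
    apply: Bind; last by rewrite upE.
    move=> t; apply: contraPP => nBt; rewrite -mcoeff_neq0; apply/negP.
    rewrite negbK; apply/eqP; rewrite /up /lext raddf_sum big1 // => b _ /=.
    rewrite mcoeffZ mcoeffU; case: eqP => [e|]; last by rewrite mulr0.
    by case: nBt; rewrite -e; apply/asboolP/(valP b).
  apply/malgP => b; rewrite mcoeff0.
  have <- : (up m)@_(sval b) = m@_b; last by rewrite upm mcoeff0.
  rewrite -[in RHS](lext_id m) /up /lext !raddf_sum; apply: eq_bigr => c _ /=.
  by rewrite !mcoeffZ !mcoeffU.
have [m Bm Wm] := maximal_spans Bind Bmax t.
exists (lext (fun u => oapp (fun b => << b >>) 0 (insub u)) m).
rewrite (linear_lext (lext (w \o sval))) [X in W (_ - X)](_ : _ = lext w m) //.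
apply: eq_big_seq => u /Bm Bu /=; congr (_ *: _).
by case: insubP => [b _ <-|/asboolP //]; apply: lext1.
Qed.

End Basis.

(** * The Jacobson radical *)

Section Radical.
Context {k : fieldType} {L : nuAlgType k}.

Lemma linear_prop0 (U V : lmodType k) (f : U -> V) : linear f -> f 0 = 0.
Proof. by move=> h; move: (h (-1) 0 0); rewrite scaler0 addr0 scaleN1r addNr. Qed.

(** In a simple module the submodule annihilated by [N] is everything or zero;
    if it were zero, then [N^(n+1) M = 0] would force [N^n M = 0], all the way
    down to [N M = 0]. *)
Lemma nilpotent_sub_jacobson (N : set L) :
  is_ideal N -> is_nilpotent N -> N `<=` jacobson L.
Proof.
move=> idN [n n0 Nn] x Nx M act [[actM actl actr] _ simp] m.
pose M0 := [set m : M | forall y, N y -> act y m = 0].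
case: (simp M0) => [||||M0T].
- by move=> y _; apply: linear_prop0.
- by move=> c m1 m2 h1 h2 y Ny; rewrite actl h1 // h2 // scaler0 addr0.
- by move=> y m1 h z Nz; rewrite -actM; apply: h; case: idN => _ _; apply.
- move=> M00.
  have down j : (forall y, set_exp N j.+2 y -> forall m, act y m = 0) ->
      forall y, set_exp N j.+1 y -> forall m, act y m = 0.
    move=> IH y Ny m1; suff: M0 (act y m1) by rewrite M00.
    move=> z Nz; rewrite -actM; apply: IH; apply: set_exp_mull => //.
    by case: idN.
  have: forall y, set_exp N n.-1.+1 y -> forall m, act y m = 0.
    rewrite prednK // => y /Nn -> m1.
    exact: linear_prop0 (actr m1).
  by elim: n.-1 => [h|j IHj /down]; first exact: h.
- have M0m : M0 m by rewrite M0T.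
  exact: M0m.
Qed.

(** An algebra morphism to the field is a one-dimensional module, which is
    simple as soon as the morphism is not zero. *)
Lemma jacobson_character (c : L -> k) : linear (c : L -> k^o) ->
  {morph c : x y / x ** y >-> x * y} -> (exists x, c x != 0) ->
  forall x, ideal_set (jacobson L) x -> c x = 0.
Proof.
move=> clin cM [x0 cx0] x jx.
suff /(jx k^o (fun y m => c y * m))/(_ 1) : is_simple_module (fun y (m : k^o) => c y * m).
  by rewrite mulr1.
split; first split.
- by move=> y z m; rewrite cM mulrA.
- by move=> y d m1 m2; rewrite mulrDr; congr (_ + _); apply: mulrCA.
- by move=> m d y z; rewrite clin mulrDl; congr (_ + _); rewrite -mulrA.
- by exists x0, 1; rewrite mulr1.
move=> N N0 Nlin _; have [[m Nm m0]|h] := pselect (exists2 m, N m & m != 0).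
  right; apply/seteqP; split=> // m1 _.
  have := Nlin (m1 / m) m 0 Nm N0.
  by rewrite addr0 [_ *: _]mulfVK.
left; apply/seteqP; split=> [m Nm|_ -> //].
by apply/eqP; apply: contrapT => /negP m0; apply: h; exists m.
Qed.

End Radical.

(** * Direct sums of copies of the field, and path algebras *)

Section DirectSumFacts.
Context {k : fieldType} {I : choiceType}.

Definition dsum_lext (V : lmodType k) (g : I -> V) : dsum k I -> V := lext g.
HB.instance Definition _ (V : lmodType k) (g : I -> V) :=
  GRing.isLinear.Build k (dsum k I) V _ (dsum_lext g) (lext_linear g).

Lemma dsum_lext1 (V : lmodType k) (g : I -> V) i : dsum_lext g << i >> = g i.
Proof. exact: lext1. Qed.

Lemma dsum_numulE (x y : dsum k I) i :
  (x ** y)@_i = x@_i * y@_i.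
Proof. exact: dsum_mulE. Qed.

Lemma dsum_numul1 (i j : I) :
  (<< i >> : dsum k I) ** << j >> = if i == j then << i >> else 0.
Proof.
apply/malgP => l; rewrite dsum_numulE !mcoeffU.
case: (eqVneq i j) => [<-|ij].
  by rewrite mcoeffU; case: eqP; rewrite ?mulr1 ?mulr0.
rewrite mcoeff0; case: (eqVneq i l) => [il|]; last by rewrite mul0r.
by rewrite -il eq_sym (negbTE ij) mulr0.
Qed.

Lemma dsum_morph (B : nuAlgType k) (f : {linear dsum k I -> B}) :
  (forall i j, f << i >> ** f << j >> = if i == j then f << i >> else 0) ->
  mult_morph f.
Proof.
have scale c i : << c *g i >> = c *: << i >> :> dsum k I.
  by apply/malgP=> j; rewrite mcoeffZ !mcoeffU mulrnAr mulr1.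
move=> fU; apply: (malg_ind (P := fun x : dsum k I => forall y, f (x ** y) = f x ** f y)).
- by move=> y; rewrite numul0l linear0 numul0l.
- by move=> x1 x2 h1 h2 y; rewrite numulDl !linearD numulDl h1 h2.
move=> c i; apply: (malg_ind (K := I)) => [|y1 y2 h1 h2|d j].
- by rewrite numul0r linear0 numul0r.
- by rewrite numulDr !linearD numulDr h1 h2.
rewrite (scale c i) (scale d j) -!nuscaleAl -!nuscaleAr !linearZ /= -nuscaleAl -nuscaleAr fU.
by rewrite dsum_numul1; case: eqP => // _; rewrite linear0.
Qed.

End DirectSumFacts.

Section PathAlgebraFacts.
Context {k : fieldType} {D : quiver}.
Local Notation kD := (path_alg k D).
Local Notation J := (arrow_ideal k D).
Local Notation path p := (<< p >> : kD).

Definition path_lext (V : lmodType k) (g : qpath D -> V) : kD -> V := lext g.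
HB.instance Definition _ (V : lmodType k) (g : qpath D -> V) :=
  GRing.isLinear.Build k kD V _ (@path_lext V g) (lext_linear g).

Lemma path_lext1 (V : lmodType k) (g : qpath D -> V) p :
  path_lext g (path p) = g p.
Proof. exact: lext1. Qed.

Lemma path_mulU c d p q : (<< c *g p >> : kD) ** << d *g q >> =
  oapp (fun r => << c * d *g r >>) 0 (pcat p q).
Proof. exact: path_mulUU. Qed.

Lemma path_mul1 p q : path p ** path q = oapp (fun r => path r) 0 (pcat p q).
Proof. by rewrite path_mulU mulr1. Qed.

Lemma path_scale c p : << c *g p >> = c *: path p :> kD.
Proof. by rewrite path_scaleU mulr1. Qed.

Lemma path_linearU (V : lmodType k) (f : {linear kD -> V}) c p :
  f << c *g p >> = c *: f (path p).
Proof. by rewrite path_scale; apply: linearZ_LR. Qed.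

Lemma path_morph (B : nuAlgType k) (f : {linear kD -> B}) :
  (forall p q, f (path p) ** f (path q) =
               oapp (fun r => f (path r)) 0 (pcat p q)) ->
  mult_morph f.
Proof.
move=> fU; apply: (path_alg_ind (P := fun x => forall y, f (x ** y) = f x ** f y)).
- by move=> y; rewrite numul0l linear0 numul0l.
- by move=> x1 x2 h1 h2 y; rewrite numulDl !linearD numulDl h1 h2.
move=> c p; apply: path_alg_ind => [|y1 y2 h1 h2|d q].
- by rewrite numul0r linear0 numul0r.
- by rewrite numulDr !linearD numulDr h1 h2.
apply: etrans (congr1 f (path_mulU c d p q)) _; apply: esym.
apply: etrans (congr2 numul (path_linearU f c p) (path_linearU f d q)) _.
rewrite -nuscaleAl -nuscaleAr fU scalerA.
case: (pcat p q) => [r|] /=; first exact: esym (path_linearU f (c * d) r).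
by rewrite scaler0 linear0.
Qed.

Lemma vertex_path_mul i p : path (vertex_path i) ** path p =
  if i == psrc p then path p else 0.
Proof.
rewrite path_mul1; case: pcatP => [r e s _ a|/negbTE -> //].
rewrite -[i]/(ptgt (vertex_path i)) e eqxx; congr << _ >>.
by apply: qpath_eq; rewrite ?a // s.
Qed.

Lemma path_mul_vertex i p : path p ** path (vertex_path i) =
  if ptgt p == i then path p else 0.
Proof.
rewrite path_mul1; case: pcatP => [r e s _ a|/negbTE]; last by move=> ->.
rewrite e eqxx; congr << _ >>.
by apply: qpath_eq; rewrite ?a ?cats0 // s.
Qed.

Lemma subspace_support (A : set kD) x :
  is_subspace A -> (forall p, x@_p != 0 -> A (path p)) -> A x.
Proof.
move=> sA hx.
have -> : x = \sum_(p <- msupp x) x@_p *: path p by exact: esym (lext_id x).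
apply: subspace_sum_seq => // p.
by rewrite -mcoeff_neq0 => /hx; case: sA => _ _; apply.
Qed.

Lemma path_cons p a s : parrows p = a :: s ->
  exists2 q : qpath D, parrows q = s & path p = path (arrow_path a) ** path q.
Proof.
move=> ep; have : is_walk (atgt a, s).1 (atgt a, s).2.
  by move: (qpath_walk p); rewrite -/(parrows p) ep /= => /andP[].
move=> wq; exists (QPath wq) => //; rewrite path_mul1.
case: pcatP => [r _ sr _ ar|]; last by rewrite eqxx.
congr << _ >>; apply: qpath_eq; last by rewrite ar ep.
rewrite sr; move: (qpath_walk p); rewrite -/(parrows p) ep /= => /andP[/eqP e _].
exact: esym e.
Qed.

Lemma arrow_idealP : is_ideal J. Proof. exact: idealP. Qed.

Lemma arrow_ideal_subspace : is_subspace J.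
Proof. by case: arrow_idealP. Qed.

Lemma arrow_in_J a : ideal_set J (path (arrow_path a)).
Proof. by apply: sub_ideal_gen; exists a. Qed.

Lemma path_in_J p : parrows p != [::] -> ideal_set J (path p).
Proof.
case ep : (parrows p) => [//|a s] _; have [q _ ->] := path_cons ep.
by case: arrow_idealP => _ _; apply; apply: arrow_in_J.
Qed.

Lemma path_in_J2 p : (1 < size (parrows p))%N -> set_exp J 2 (path p).
Proof.
case ep : (parrows p) => [//|a [//|b s]] _; have [q eq ->] := path_cons ep.
by apply: set_mul_mem; [apply: arrow_in_J | apply: path_in_J; rewrite eq].
Qed.

Definition vertex_part : {linear kD -> dsum k (vertex D)} :=
  path_lext (fun p => if parrows p is [::] then << psrc p >> else 0).

Lemma vertex_partE p : vertex_part (path p) =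
  if parrows p is [::] then << psrc p >> else 0.
Proof. exact: path_lext1. Qed.

Lemma vertex_part_morph : mult_morph vertex_part.
Proof.
apply: path_morph => p q.
apply: etrans (congr2 numul (vertex_partE p) (vertex_partE q)) _.
case: pcatP => [r e s t a|ne] /=; last first.
  case ep : (parrows p) => [|//]; last by rewrite numul0l.
  case: (parrows q) => [|//]; last by rewrite numul0r.
  rewrite dsum_numul1; case: eqP => // e; case/eqP: ne.
  by rewrite /ptgt ep.
rewrite vertex_partE a s.
case ep : (parrows p) => [|//]; last by rewrite numul0l.
case: (parrows q) => [|//]; last by rewrite numul0r.
by rewrite dsum_numul1; move: e; rewrite /ptgt ep /= => ->; rewrite eqxx.
Qed.

Lemma vertex_part_coef x i : (vertex_part x)@_i = x@_(vertex_path i).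
Proof.
elim/path_alg_ind: x => [|x y hx hy|c p].
- by rewrite linear0 !mcoeff0.
- by rewrite linearD !mcoeffD hx hy.
rewrite (path_linearU vertex_part c p) vertex_partE mcoeffZ mcoeffU.
case ep: (parrows p) => [|a s].
  rewrite mcoeffU mulrnAr mulr1; congr (_ *+ nat_of_bool _).
  by apply/eqP/eqP => [e|-> //]; apply: qpath_eq.
by rewrite mcoeff0 mulr0; case: eqP => // e; rewrite e in ep.
Qed.

(** The vertex part is a morphism that vanishes on the arrows, so it kills
    [J]; conversely a combination of paths of positive length is in [J]. *)
Lemma arrow_idealE x : ideal_set J x <-> vertex_part x = 0.
Proof.
split=> [Jx|vx0].
  suff : ideal_set (ker_ideal vertex_part_morph) x by [].
  apply: ideal_gen_sub Jx => _ [a _ <-].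
  exact: vertex_partE.
apply: subspace_support; first exact: arrow_ideal_subspace.
move=> p xp; apply: path_in_J; apply: contraNneq xp => ep.
have -> : p = vertex_path (psrc p) by apply: qpath_eq.
by rewrite -vertex_part_coef vx0 mcoeff0.
Qed.

Lemma vertex_part_surj : surj vertex_part.
Proof.
move=> y; exists (lext (fun i => path (vertex_path i)) y).
rewrite linear_lext -[RHS](lext_id y); apply: eq_bigr => i _ /=.
by rewrite vertex_partE.
Qed.

End PathAlgebraFacts.

(** * Sums of orthogonal idempotents *)

Section Idempotents.
Context {k : fieldType} {L : nuAlgType k} {I : choiceType} (e : I -> L).
Hypothesis eM : forall i j, e i ** e j = if i == j then e i else 0.

Definition idem_sum (G : {fset I}) : L := \sum_(i <- G) e i.

Lemma idem_sum_mull G i : i \in G -> idem_sum G ** e i = e i.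
Proof.
move=> iG; rewrite /idem_sum numul_suml (bigD1_seq i) //= eM eqxx.
by rewrite big1 ?addr0 // => j /negbTE ji; rewrite eM ji.
Qed.

Lemma idem_sum_mulr G i : i \in G -> e i ** idem_sum G = e i.
Proof.
move=> iG; rewrite /idem_sum numul_sumr (bigD1_seq i) //= eM eqxx.
by rewrite big1 ?addr0 // => j /negbTE ji; rewrite eM eq_sym ji.
Qed.

Lemma idem_sum_absorb F G : (F `<=` G)%fset ->
  idem_sum G ** idem_sum F = idem_sum F /\ idem_sum F ** idem_sum G = idem_sum F.
Proof.
move=> /fsubsetP FG; split.
  rewrite {2 3}/idem_sum numul_sumr.
  by apply: eq_big_seq => i /FG; apply: idem_sum_mull.
rewrite {1 3}/idem_sum numul_suml.
by apply: eq_big_seq => i /FG; apply: idem_sum_mulr.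
Qed.

End Idempotents.

(** * Quotients of path algebras *)

Section FromPathAlgebra.
Context {k : fieldType} {D : quiver} {L : nuAlgType k}.
Local Notation kD := (path_alg k D).
Local Notation J := (arrow_ideal k D).
Local Notation path p := (<< p >> : kD).
Variables (phi : {linear kD -> L}) (t : nat).
Hypotheses (phiM : mult_morph phi) (phiS : surj phi) (t0 : (0 < t)%N).
Hypotheses (Jt : forall x, set_exp J t x -> phi x = 0).
Hypotheses (kerJ2 : forall x, phi x = 0 -> set_exp J 2 x).

Let N : set L := phi @` J.

Let N_ideal : is_ideal N.
Proof. by apply: image_ideal => //; exact: arrow_idealP. Qed.

Let N_nilpotent : is_nilpotent N.
Proof.
exists t => // x; rewrite -(prednK t0).
move=> /(set_exp_image phiM arrow_ideal_subspace)[y Jy <-].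
by apply: Jt; rewrite -(prednK t0).
Qed.

Let phi_vertex x : phi x = 0 -> vertex_part x = 0.
Proof.
move=> /kerJ2 J2x; apply/arrow_idealE; exact: (set_exp_sub arrow_idealP J2x).
Qed.

(** The radical is the image of the arrow ideal: that image is nilpotent, and
    the coefficient at each vertex is a character, which kills the radical. *)
Lemma jacobson_image : ideal_set (jacobson L) = N.
Proof.
apply/seteqP; split=> [x jx|]; last exact: nilpotent_sub_jacobson.
have [v vM vE] := factor_surj phiM phiS vertex_part_morph phi_vertex.
have [y yx] := phiS x; exists y => //; apply/arrow_idealE.
rewrite -vE yx; apply/malgP => i; rewrite mcoeff0.
apply: (jacobson_character (c := fun z => (v z)@_i)) jx.
- by move=> c z1 z2; rewrite linearP /= mcoeffD mcoeffZ.
- by move=> z1 z2; rewrite vM dsum_numulE.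
- exists (phi (path (vertex_path i))).
  by rewrite vE vertex_part_coef mcoeffUU oner_eq0.
Qed.

Lemma jacobson_phi x : ideal_set (jacobson L) (phi x) <-> vertex_part x = 0.
Proof.
rewrite jacobson_image -arrow_idealE; split=> [[y Jy e]|Jx]; last by exists x.
have : phi (x - y) = 0 by rewrite linearB /= e subrr.
move=> /kerJ2 /(set_exp_sub arrow_idealP) /= Jxy.
have [_ JD _] := @arrow_ideal_subspace k D.
by rewrite -(subrK y x); apply: JD.
Qed.

Lemma quotient_elementary : inhabited (vertex D) -> generalized_elementary L.
Proof.
move=> i0; exists (vertex D); split=> //.
pose pi_phi : {linear kD -> quot_alg (jacobson L)} := quot_pi (jacobson L) \o phi.
apply: (alg_iso_of_kernel (f := pi_phi) (g := vertex_part)).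
- by move=> x y /=; rewrite phiM quot_pi_morph.
- move=> z; have [y <-] := quot_pi_surj z; have [x <-] := phiS y.
  by exists x.
- exact: vertex_part_morph.
- exact: vertex_part_surj.
by move=> x; rewrite -jacobson_phi; apply: quot_pi_eq0.
Qed.

(** The complement of the radical is the image of the span of the vertices. *)
Lemma quotient_lifted : can_be_lifted L.
Proof.
pose s : {linear dsum k (vertex D) -> kD} := lext (fun i => path (vertex_path i)).
have sK y : vertex_part (s y) = y.
  rewrite linear_lext -[RHS](lext_id y); apply: eq_bigr => i _ /=.
  by rewrite vertex_partE.
have sM : mult_morph s.
  apply: dsum_morph => i j; rewrite /s /= !lext1 vertex_path_mul /=.
  by case: eqP => // ->.
exists (range (phi \o s)); split.
- split; first split.
  + by exists 0 => //; rewrite linear0.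
  + by move=> _ _ [x _ <-] [y _ <-]; exists (x + y); rewrite ?linearD.
  + by move=> c _ [x _ <-]; exists (c *: x); rewrite ?linearZ.
  + by move=> _ _ [x _ <-] [y _ <-]; exists (x ** y); rewrite //= sM phiM.
- move=> x; have [y <-] := phiS x.
  exists (phi (s (vertex_part y))), (phi (y - s (vertex_part y))); split.
  + by exists (vertex_part y).
  + by apply/jacobson_phi; rewrite linearB /= sK subrr.
  + by rewrite -linearD addrC subrK.
- apply/seteqP; split=> [_ [[y _ <-] /jacobson_phi]|_ ->].
    by rewrite /= sK => ->; rewrite !linear0.
  split; last by case: (idealP (jacobson L)) => -[].
  by exists 0 => //; rewrite linear0.
Qed.

Lemma quotient_nilpotent : is_nilpotent (jacobson L).
Proof. by rewrite jacobson_image. Qed.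

Lemma quotient_idempotents :
  inhabited (vertex D) -> has_complete_orthogonal_idempotents L.
Proof.
move=> i0; pose e i : kD := path (vertex_path i).
have eM i j : e i ** e j = if i == j then e i else 0.
  by rewrite /e vertex_path_mul; case: eqP => //= ->.
have eU x : exists F : {fset vertex D}, forall G, (F `<=` G)%fset ->
    idem_sum e G ** x = x /\ x ** idem_sum e G = x.
  elim/path_alg_ind: x => [|x y [F hF] [F' hF']|c p].
  - by exists fset0 => G _; rewrite numul0l numul0r.
  - exists (F `|` F')%fset => G; rewrite fsubUset => /andP[/hF[h1 h2] /hF'[h3 h4]].
    by rewrite numulDl numulDr h1 h2 h3 h4.
  - exists [fset psrc p; ptgt p]%fset => G.
    rewrite fsubUset !fsub1set => /andP[sG tG].
    rewrite path_scale -nuscaleAl -nuscaleAr; split; congr (_ *: _).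
      have {1}-> : path p = e (psrc p) ** path p.
        by rewrite vertex_path_mul eqxx.
      by rewrite numulA idem_sum_mull // vertex_path_mul eqxx.
    have {1}-> : path p = path p ** e (ptgt p) by rewrite path_mul_vertex eqxx.
    by rewrite -numulA idem_sum_mulr // path_mul_vertex eqxx.
exists (vertex D), (phi \o e); split=> //; split.
- by move=> i j /=; rewrite -phiM eM; case: eqP => //; rewrite linear0.
- move=> y; have [x <-] := phiS y; have [F hF] := eU x.
  exists F; rewrite -linear_sum -!phiM; have [] := hF _ (fsubset_refl F).
  by rewrite /idem_sum => -> ->.
- move=> i; apply/eqP => /= /phi_vertex /malgP/(_ i)/eqP.
  by rewrite vertex_part_coef mcoeffUU mcoeff0 oner_eq0.
Qed.

End FromPathAlgebra.

(** * Local units of a split algebra *)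

Section LocalUnits.
Context {I : choiceType} {V : zmodType}.
Variables (T : {fset I} -> V -> V) (U : nat -> set V) (n : nat).
Hypothesis TB : forall G x y, T G (x - y) = T G x - T G y.
Hypothesis TT : forall F G x, (F `<=` G)%fset -> T G (T F x) = T F x.
Hypothesis Un : forall x, U n x -> x = 0.
Hypothesis step : forall j x, U j x -> exists F, U j.+1 (x - T F x).

(** If [T F] fixes [x] up to an error one step further down the filtration,
    then enlarging [F] so that it also fixes the error makes it fix [x].  It is
    stated for operators so as to serve left and right multiplication. *)
Lemma filtration_fixed x : U 0%N x ->
  exists F, forall G, (F `<=` G)%fset -> T G x = x.
Proof.
suff H j y : (j <= n)%N -> U (n - j)%N y ->
    exists F, forall G, (F `<=` G)%fset -> T G y = y.
  by move=> Ux; apply: (H n) => //; rewrite subnn.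
elim: j y => [|j IHj] y.
  rewrite subn0 => _ /Un ->; exists fset0 => G _.
  by rewrite -{1}(subrr (0 : V)) TB subrr.
move=> jn /step[F]; rewrite subnSK // => /(IHj _ (ltnW jn))[F' hF'].
exists (F `|` F')%fset => G; rewrite fsubUset => /andP[FG /hF'].
by rewrite TB TT // => /addIr.
Qed.

End LocalUnits.

Section Split.
Context {k : fieldType} {L : nuAlgType k} {I : choiceType}.
Local Notation r := (ideal_set (jacobson L)).
Variables (pi : {linear L -> dsum k I}) (e : I -> L) (n : nat).
Hypotheses (pi_eq0 : forall x, pi x = 0 <-> r x).
Hypotheses (eM : forall i j, e i ** e j = if i == j then e i else 0).
Hypotheses (pi_e : forall i, pi (e i) = << i >>).
Hypothesis rn : forall x, set_exp r n.+1 x -> x = 0.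
Hypothesis units : forall x : L, exists u, u ** x = x /\ x ** u = x.

Let rI : is_ideal r := idealP (jacobson L).
Let rS : is_subspace r. Proof. by case: rI. Qed.
Let rnS j : is_subspace (set_exp r j) := set_exp_subspace j rS.

Lemma pi_lext c : pi (dsum_lext e c) = c.
Proof.
rewrite /dsum_lext linear_lext -[RHS](lext_id c); apply: eq_bigr => i _ /=.
by rewrite pi_e.
Qed.

Lemma split_radical x : r (x - dsum_lext e (pi x)).
Proof. by apply/pi_eq0; rewrite linearB /= pi_lext subrr. Qed.

(** The support of the image of [u] in the direct sum is a local unit for that
    image. *)
Lemma idem_sum_mod_radical u : exists F : {fset I},
  r (u - idem_sum e F ** u) /\ r (u - u ** idem_sum e F).
Proof.
exists (msupp (pi u)); set w := dsum_lext e (pi u); set f := idem_sum _ _.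
have [_ hl hr] := rI; have ru : r (u - w) := split_radical u.
have fw : f ** w = w.
  rewrite /w /dsum_lext /lext numul_sumr; apply: eq_big_seq => i iF.
  by rewrite -nuscaleAr idem_sum_mull.
have wf : w ** f = w.
  rewrite /w /dsum_lext /lext numul_suml; apply: eq_big_seq => i iF.
  by rewrite -nuscaleAl idem_sum_mulr.
split.
  have -> : u - f ** u = (u - w) - f ** (u - w).
    by rewrite numulBr fw opprB addrA subrK.
  by apply: (subspaceB rS ru); apply: hl.
have -> : u - u ** f = (u - w) - (u - w) ** f.
  by rewrite numulBl wf opprB addrA subrK.
by apply: (subspaceB rS ru); apply: hr.
Qed.

(** Each layer of the radical filtration is a module over the quotient by the
    radical, where a local unit of [L] agrees with a finite sum of the [e i];
    the filtration being finite, such sums fix the elements of [r]. *)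
Lemma radical_local_unit x : r x ->
  exists F : {fset I}, idem_sum e F ** x = x /\ x ** idem_sum e F = x.
Proof.
move=> rx.
have [F hF] : exists F, forall G, (F `<=` G)%fset -> idem_sum e G ** x = x.
  apply: (filtration_fixed (T := fun G x => idem_sum e G ** x)
            (U := fun j => set_exp r j.+1) (n := n)) => //.
  - by move=> G y z; rewrite numulBr.
  - by move=> F G y FG; rewrite numulA; have [-> _] := idem_sum_absorb eM FG.
  move=> j y ry; have [u [uy _]] := units y.
  have [F [hu _]] := idem_sum_mod_radical u; exists F.
  by rewrite -{1}uy -{2}uy numulA -numulBl; apply: set_exp_mull.
have [F' hF'] : exists F, forall G, (F `<=` G)%fset -> x ** idem_sum e G = x.
  apply: (filtration_fixed (T := fun G x => x ** idem_sum e G)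
            (U := fun j => set_exp r j.+1) (n := n)) => //.
  - by move=> G y z; rewrite numulBl.
  - by move=> G' G y FG; rewrite -numulA; have [_ ->] := idem_sum_absorb eM FG.
  move=> j y ry; have [u [_ yu]] := units y.
  have [G [_ hu]] := idem_sum_mod_radical u; exists G.
  by rewrite -{1}yu -{2}yu -numulA -numulBr; apply: set_exp_mulr.
exists (F `|` F')%fset.
by rewrite hF ?fsubsetUl // hF' ?fsubsetUr.
Qed.

(** * The path algebra on a basis of the radical modulo its square *)

Section Presentation.
Variables (K : choiceType) (src tgt : K -> I) (v : K -> L).
Hypotheses (v_rad : forall b, r (v b)).
Hypotheses (src_v : forall b, e (src b) ** v b = v b).
Hypotheses (v_tgt : forall b, v b ** e (tgt b) = v b).
Hypothesis v_indep : forall m : {malg k[K]}, set_exp r 2 (lext v m) -> m = 0.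
Hypothesis v_span : forall i j x, r x ->
  exists m : {malg k[K]}, set_exp r 2 (e i ** x ** e j - lext v m).

Let D := Quiver src tgt.
Local Notation kD := (path_alg k D).
Local Notation J := (ideal_set (arrow_ideal k D)).
Local Notation path p := (<< p >> : kD).

Let fold_v : L -> seq K -> L := foldl (fun x b => x ** v b).

Definition path_value (p : qpath D) : L := fold_v (e (psrc p)) (parrows p).

Definition presentation : {linear kD -> L} := path_lext path_value.

Lemma presentationE p : presentation (path p) = path_value p.
Proof. exact: path_lext1. Qed.

Let fold_v_mull x y s : x ** fold_v y s = fold_v (x ** y) s.
Proof. by elim: s y => //= b s IHs y; rewrite IHs numulA. Qed.

Let fold_v_tgt i x s : x ** e i = x ->
  fold_v x s ** e (last i (map tgt s)) = fold_v x s.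
Proof.
by elim: s i x => //= b s IHs i x xi; apply: IHs; rewrite -numulA v_tgt.
Qed.

Let path_value_tgt p : path_value p ** e (ptgt p) = path_value p.
Proof. by apply: fold_v_tgt; rewrite eM eqxx. Qed.

Lemma presentation_morph : mult_morph presentation.
Proof.
apply: path_morph => p q.
apply: etrans (congr2 numul (presentationE p) (presentationE q)) _.
rewrite {2}/path_value fold_v_mull.
case: pcatP => [s pq es _ er|pq] /=.
  apply: esym; apply: etrans (presentationE s) _.
  by rewrite -pq path_value_tgt /path_value es er /fold_v foldl_cat.
rewrite -path_value_tgt -numulA eM (negbTE pq) numul0r.
by elim: (parrows q) => //= b s IHs; rewrite numul0l.
Qed.

Let path_value_vertex p : parrows p = [::] -> path_value p = e (psrc p).
Proof. by rewrite /path_value => ->. Qed.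

Let path_value_arrow p b : parrows p = [:: b] -> path_value p = v b.
Proof.
rewrite /path_value => pb; rewrite pb /=.
move: (qpath_walk p); rewrite -/(parrows p) pb /= andbT => /eqP src_b.
by rewrite /psrc -src_b.
Qed.

Lemma presentation_J x : J x -> r (presentation x).
Proof.
pose P := Ideal (preimage_ideal presentation_morph rI).
suff JP : J `<=` P by move/JP.
apply: ideal_gen_sub => _ [b _ <-]; rewrite /P /= /preimage /=.
rewrite presentationE (path_value_arrow (b := b)) //; exact: v_rad.
Qed.

Lemma presentation_Jn j x : set_exp J j.+1 x -> set_exp r j.+1 (presentation x).
Proof.
by apply: set_exp_morph => //; [exact: presentation_morph | exact: presentation_J].
Qed.

Let approx j : set L :=
  [set x | exists2 y, J y & set_exp r j.+2 (x - presentation y)].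

Let approx_subspace j : is_subspace (approx j).
Proof.
have [J0 JD JZ] := @arrow_ideal_subspace k D; have [r0 rD rZ] := rnS j.+2.
split.
- by exists 0 => //; rewrite linear0 subr0.
- move=> x y [x' Jx hx] [y' Jy hy]; exists (x' + y'); first exact: JD.
  by rewrite linearD /= opprD addrACA; apply: rD.
- move=> c x [x' Jx hx]; exists (c *: x'); first exact: JZ.
  by rewrite linearZ /= -scalerBr; apply: rZ.
Qed.

Let presentation_lext_v m :
  presentation (lext (fun b => path (arrow_path b)) m) = lext v m.
Proof.
rewrite (linear_lext presentation); apply: eq_bigr => b _ /=.
by rewrite presentationE (path_value_arrow (b := b)).
Qed.

Let radical_approx x : r x -> approx 0 x.
Proof.
move=> rx; have [F [Fx xF]] := radical_local_unit rx.
rewrite -xF -Fx /idem_sum numul_suml numul_suml.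
apply: subspace_sum => // i _; rewrite numul_sumr.
apply: subspace_sum => // j _.
have [m hm] := v_span i j rx.
exists (lext (fun b => path (arrow_path b)) m); last by rewrite presentation_lext_v.
have [_ _ JZ] := @arrow_ideal_subspace k D.
by apply: subspace_sum => [|b _]; [exact: arrow_ideal_subspace | apply/JZ/arrow_in_J].
Qed.

(** Generators of the radical modulo its square generate every power of the
    radical modulo the next one. *)
Let radical_power_approx j x : set_exp r j.+1 x -> approx j x.
Proof.
elim: j x => [|j IHj]; first exact: radical_approx.
rewrite set_expS; apply: set_mul_sub => // x z rx rz.
have [y Jy hx] := IHj x rx; have [y' Jy' hz] := radical_approx rz.
exists (y ** y'); first by have [_ hl _] := @arrow_idealP k D; apply: hl.
rewrite presentation_morph.
have -> : x ** z - presentation y ** presentation y' =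
    x ** (z - presentation y') + (x - presentation y) ** presentation y'.
  by rewrite numulBl numulBr addrA subrK.
have [_ rD _] := rnS j.+3; apply: rD; first exact: set_exp_mul_sqr.
by apply: set_exp_mulr => //; apply: presentation_J.
Qed.

Let radical_image x : r x -> exists y, presentation y = x.
Proof.
suff H j y : (j <= n)%N -> set_exp r (n - j).+1 y ->
    exists z, presentation z = y.
  by move=> rx; apply: (H n) => //; rewrite subnn.
elim: j y => [|j IHj] y.
  by rewrite subn0 => _ /rn ->; exists 0; rewrite linear0.
move=> jn /radical_power_approx[z _].
rewrite subnSK // => /(IHj _ (ltnW jn))[z' hz'].
by exists (z' + z); rewrite linearD /= hz' subrK.
Qed.

(** The radical is reached by descending along its powers, and the span of the
    [e i] is the image of the vertices. *)
Lemma presentation_surj : surj presentation.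
Proof.
move=> x; have [y hy] := radical_image (split_radical x).
exists (y + lext (fun i : vertex D => path (vertex_path i)) (pi x)).
rewrite linearD /= hy.
suff -> : presentation (lext (fun i : vertex D => path (vertex_path i)) (pi x)) =
          dsum_lext e (pi x) by rewrite subrK.
rewrite (linear_lext presentation); apply: eq_bigr => i _ /=.
by rewrite presentationE.
Qed.

Definition arrow_part : {linear kD -> {malg k[K]}} :=
  path_lext (fun p => if parrows p is [:: b] then << b >> else 0).

Let arrow_partE p : arrow_part (path p) =
  if parrows p is [:: b] then << b >> else 0.
Proof. exact: path_lext1. Qed.

Let arrow_part_coef x b : (arrow_part x)@_b = x@_(arrow_path (b : arrow D)).
Proof.
elim/path_alg_ind: x => [|x y hx hy|c p].
- by rewrite linear0 !mcoeff0.
- by rewrite linearD !mcoeffD hx hy.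
rewrite (path_linearU arrow_part c p) arrow_partE mcoeffZ mcoeffU.
have [->|ne] := eqVneq p (arrow_path (b : arrow D)).
  by rewrite mcoeffUU mulr1.
case ep: (parrows p) => [|b' [|b'' s]]; rewrite ?mcoeff0 ?mulr0 //.
rewrite mcoeffU; case: eqP => [e'|]; last by rewrite mulr0.
case/eqP: ne; apply: qpath_eq; last by rewrite ep e'.
by move: (qpath_walk p); rewrite -/(parrows p) ep /= andbT e' => /eqP.
Qed.

(** Modulo [r^2] only the paths of length 0 and 1 contribute. *)
Let presentation_mod_sqr x :
  set_exp r 2 (presentation x - dsum_lext e (vertex_part x) - lext v (arrow_part x)).
Proof.
have [r0 rD rZ] := rnS 2.
apply: (subspace_support (A := [set x | set_exp r 2
  (presentation x - dsum_lext e (vertex_part x) - lext v (arrow_part x))])).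
  split.
  - by rewrite /= !linear0 !addr0.
  - move=> y z hy hz; rewrite /= !linearD /=.
    rewrite [X in X + _]addrACA [X in set_mul _ _ X]addrACA.
    exact: rD hy hz.
  - by move=> c y hy; rewrite /= !linearZ /= -!scalerDr; apply: rZ.
move=> p _; rewrite /= vertex_partE arrow_partE presentationE.
case ep: (parrows p) => [|b [|b' s]].
- by rewrite dsum_lext1 linear0 subr0 path_value_vertex // subrr.
- by rewrite lext1 linear0 subr0 (path_value_arrow ep) subrr.
rewrite !linear0 !addr0 -presentationE; apply: (presentation_Jn (j := 1)).
by apply: path_in_J2; rewrite ep.
Qed.

(** Applying [pi] to [presentation x = 0] shows that the vertices do not occur in
    [x]; the arrows then do not occur by their independence modulo [r^2]. *)
Lemma presentation_ker x : presentation x = 0 -> set_exp J 2 x.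
Proof.
move=> px0; have := presentation_mod_sqr x; rewrite px0 sub0r => h.
have r_lext_v m : r (lext v m).
  by apply: subspace_sum => // b _; case: rS => _ _; apply.
have vp0 : vertex_part x = 0.
  rewrite -(pi_lext (vertex_part x)); apply/pi_eq0.
  have h1 : r (dsum_lext e (vertex_part x) + lext v (arrow_part x)).
    by apply: (subspaceN rS); rewrite opprD; apply: (set_exp_sub rI h).
  by rewrite -(addrK (lext v (arrow_part x)) (dsum_lext e _)); apply: subspaceB rS h1 _.
have ap0 : arrow_part x = 0.
  apply: v_indep; move: h; rewrite vp0 linear0 oppr0 sub0r.
  exact: subspaceN.
apply: subspace_support; first exact/set_exp_subspace/arrow_ideal_subspace.
move=> p; apply: contraNP => hp; apply/eqP.
case ep: (parrows p) => [|b [|b' s]]; last by case: hp; apply: path_in_J2; rewrite ep.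
  have -> : p = vertex_path (psrc p) by apply: qpath_eq.
  by rewrite -vertex_part_coef vp0 mcoeff0.
have -> : p = arrow_path (b : arrow D).
  apply: qpath_eq => //.
  by move: (qpath_walk p); rewrite -/(parrows p) ep /= andbT => /eqP.
by rewrite -arrow_part_coef ap0 mcoeff0.
Qed.

(** The relations are all the elements of the kernel, which is its own generated
    ideal. *)
Lemma presented : inhabited I -> is_path_algebra_with_relations L.
Proof.
move=> i0; pose R := ker_ideal presentation_morph.
exists D, R; split=> //; last first.
  apply: (alg_iso_of_kernel (f := presentation) (g := quot_pi (ideal_gen R))).
  - exact: presentation_morph.
  - exact: presentation_surj.
  - exact: quot_pi_morph.
  - exact: quot_pi_surj.
  by move=> x; rewrite quot_pi_eq0 ideal_gen_id.
split; first by exists 0; rewrite /R /= /preimage /= linear0.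
rewrite ideal_gen_id; exists n.+1 => //; split=> x.
  by move=> /presentation_Jn /rn.
exact: presentation_ker.
Qed.

End Presentation.
End Split.

(** * The characterization *)

Section Conclusion.
Context {k : fieldType} {L : nuAlgType k}.

Lemma path_algebra_with_relations_sufficient :
  is_path_algebra_with_relations L ->
  [/\ generalized_elementary L, can_be_lifted L,
      is_nilpotent (jacobson L) & has_complete_orthogonal_idempotents L].
Proof.
case=> D [rho [i0 [_ [t t0 [Jt rhoJ2]]] [f [fbij fM]]]].
have fS : surj f by case: fbij => g _ gK y; exists (g y).
have finj : injective f := bij_inj fbij.
have [h hM hf] : exists2 h : {linear quot_alg (ideal_gen rho) -> L},
    mult_morph h & forall x, h (f x) = x.
  apply: (factor_surj (g := idfun) fM fS) => // x.
  by rewrite -[RHS](linear0 f) => /finj.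
pose phi : {linear path_alg k D -> L} := h \o quot_pi (ideal_gen rho).
have phiM : mult_morph phi by move=> x y /=; rewrite quot_pi_morph hM.
have phiS : surj phi.
  by move=> x; have [y yx] := quot_pi_surj (f x); exists y; rewrite /= yx hf.
have phi0 x : phi x = 0 <-> ideal_set (ideal_gen rho) x.
  rewrite -quot_pi_eq0 /phi /=; split=> [|->]; last by rewrite linear0.
  by have [y <-] := fS (quot_pi (ideal_gen rho) x); rewrite hf => ->; rewrite linear0.
have phiJ x : set_exp (arrow_ideal k D) t x -> phi x = 0.
  by move=> /Jt /phi0.
have phiJ2 x : phi x = 0 -> set_exp (arrow_ideal k D) 2 x.
  by move=> /phi0 /rhoJ2.
split.
- exact: (quotient_elementary phiM phiS t0).
- exact: (quotient_lifted phiM phiS t0).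
- exact: (quotient_nilpotent phiM phiS t0).
- exact: (quotient_idempotents phiM phiS).
Qed.

Lemma path_algebra_with_relations_necessary :
  [/\ generalized_elementary L, can_be_lifted L,
      is_nilpotent (jacobson L) & has_complete_orthogonal_idempotents L] ->
  is_path_algebra_with_relations L.
Proof.
case=> -[I [i0 [f [fbij fM]]]] [A [[sA AM] AJ AI]] [n n0 Jn] [I' [f' [_ [_ f'U _]]]].
have finj : injective f := bij_inj fbij.
pose pi : {linear L -> dsum k I} := f \o quot_pi (jacobson L).
have piM : mult_morph pi by move=> x y /=; rewrite quot_pi_morph fM.
have pi_eq0 x : pi x = 0 <-> ideal_set (jacobson L) x.
  rewrite -quot_pi_eq0 /pi /=; split=> [|->]; last by rewrite linear0.
  by rewrite -[RHS](linear0 f) => /finj.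
have lift i : exists x, A x /\ pi x = << i >>.
  have [g _ gK] := fbij.
  have [y yE] := quot_pi_surj (g << i >>).
  have [x [r [Ax /pi_eq0 r0 yxr]]] := AJ y; exists x; split=> //.
  have <- : pi y = << i >> by rewrite /pi /= yE gK.
  by rewrite yxr linearD r0 addr0.
have [e /all_and2[eA epi]] := choice lift.
(* Relations between the [e i] can be checked modulo the radical. *)
have Ainj x y : A x -> A y -> pi x = pi y -> x = y.
  move=> Ax Ay xy; apply/eqP; rewrite -subr_eq0; apply/eqP.
  have : (A `&` jacobson L) (x - y).
    split; first exact: subspaceB.
    by apply/pi_eq0/eqP; rewrite linearB subr_eq0; apply/eqP.
  by rewrite AI.
have eM i j : e i ** e j = if i == j then e i else 0.
  apply: Ainj; first exact: AM.
    by case: eqP => // _; case: sA.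
  by rewrite piM !epi dsum_numul1; case: eqP; rewrite ?epi ?linear0.
have Jn0 x : set_exp (jacobson L) n.-1.+1 x -> x = 0.
  by rewrite prednK // => /Jn.
have units (x : L) : exists u, u ** x = x /\ x ** u = x.
  by have [F hF] := f'U x; exists (\sum_(i <- F) f' i).
(* All corners of radical elements, from which the arrows are chosen. *)
pose T := (I * I * {x : L | `[< ideal_set (jacobson L) x >]})%type.
pose w (t : T) := e t.1.1 ** sval t.2 ** e t.1.2.
have rI := idealP (jacobson L); have [rS rl rr] := rI.
have [K [u [uind uspan]]] := basis_modulo w (set_exp_subspace 2 rS).
apply: (presented pi_eq0 eM epi Jn0 units (src := fun b => (u b).1.1)
          (tgt := fun b => (u b).1.2) (v := w \o u)) => // [b|b|b|i j x rx] /=.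
- by apply/rr/rl/asboolP/(valP (u b).2).
- by rewrite /w !numulA eM eqxx.
- by rewrite /w -!numulA eM eqxx.
have [m hm] := uspan (i, j, exist _ x (asboolT rx)).
by exists m.
Qed.

End Conclusion.

Theorem corollary3p14 (k : fieldType) (L : nuAlgType k) :
  [/\ generalized_elementary L, can_be_lifted L,
      is_nilpotent (jacobson L) & has_complete_orthogonal_idempotents L]
  <-> is_path_algebra_with_relations L.
Proof.
split; first exact: path_algebra_with_relations_necessary.
exact: path_algebra_with_relations_sufficient.
Qed.
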